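(* Let $\Gamma$ be a finite abelian group of order $m$ (written additively) and let $H\subseteq\Gamma$ be an aperiodic generating set of $\Gamma$. Fix a probability distribution on $H$ giving every element of $H$ positive probability; for each $n$ let $N=\{1,\dots,n\}$ and let $\omega(x)$, $x\in N$, be i.i.d. $H$-valued random variables with this distribution, and $\omega(A)=\sum_{x\in A}\omega(x)$ for $A\subseteq N$. Let $\Pi$ be a fixed Cayley poset with $\ell$ distinct elements $(\gamma_1,j_1),\dots,(\gamma_\ell,j_\ell)$ that is strongly diamond-free, and let $$\mathcal{F}(N,\omega,\Pi)=\bigcup_{i=1}^{\ell}\{A\subseteq N: |A|=\lfloor n/2\rfloor+j_i,\ \omega(A)=\gamma_i\}.$$ Then $$\frac{\ell}{m}=\lim_{n\to\infty}\frac{\mathrm{E}[|\mathcal{F}(N,\omega,\Pi)|]}{\binom{n}{\lfloor n/2\rfloor}}\le\liminf_{n\to\infty}\frac{La(n,D_2)}{\binom{n}{\lfloor n/2\rfloor}}.$$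
   Context: $La(n,D_2)$ is the maximum size of a family of subsets of $\{1,\dots,n\}$ that is diamond-free, i.e. contains no four distinct sets $A,B,C,D$ with $A\subseteq B\subseteq D$ and $A\subseteq C\subseteq D$. $H$ is aperiodic if the gcd of $\{\ell\ge1:\exists\,\eta_1,\dots,\eta_\ell\in H,\ \eta_1+\dots+\eta_\ell=0\}$ is $1$. Infinite Cayley poset $P(\Gamma,H)$: elements are pairs $(\gamma,i)$, $\gamma\in\Gamma$, $i\in\mathbb{Z}$, with $(\gamma,i)\preceq(\delta,j)$ iff $j\ge i$ and $\delta=\gamma+\eta'_1+\dots+\eta'_{j-i}$ for some $\eta'_k\in H$; a Cayley poset is a finite subset of it with the induced order. A Cayley poset is diamond-free if it has no four distinct elements $a,b,c,d$ with $a\preceq b\preceq d$, $a\preceq c\preceq d$. Three distinct elements $(\gamma_1,i_1)\prec(\gamma_2,i_2)\prec(\gamma_3,i_3)$ form a strong chain if some $\eta\in H$ occurs as a term both in some representation of $\gamma_2-\gamma_1$ as a sum of $i_2-i_1$ elements of $H$ and in some representation of $\gamma_3-\gamma_2$ as a sum of $i_3-i_2$ elements of $H$. A Cayley poset is strongly diamond-free if it is diamond-free and has no strong chain. *)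

(* Defs.v *)
From HB Require Import structures.
From mathcomp Require Import all_boot all_order all_algebra all_fingroup.
From mathcomp Require Import finmap.
From mathcomp Require Import all_classical all_reals all_analysis.

Set Implicit Arguments.
Unset Strict Implicit.
Unset Printing Implicit Defensive.

Import Order.TTheory GRing.Theory Num.Theory.
Import numFieldNormedType.Exports.

Local Open Scope ring_scope.

Section Diamonds.

(* The pattern is weak: [b] and [c] may be comparable, so a chain of four
   elements also counts as a diamond. *)
Definition diamond_free (T : eqType) (le : T -> T -> Prop) (S : {pred T}) :
    Prop :=
  ~ exists a b c d : T,
      [/\ [/\ a \in S, b \in S, c \in S & d \in S],
          uniq [:: a; b; c; d],
          le a b /\ le b d
        & le a c /\ le c d].

Definition La_diamond (n : nat) : nat :=
  \max_(F : {set {set 'I_n}} |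
        `[< diamond_free (fun A B : {set 'I_n} => A \subset B) (mem F) >]) #|F|.

End Diamonds.

Section CayleyPosets.
Variables (G : finZmodType) (H : {set G}).

Definition is_representation (k : nat) (g : G) (s : seq G) : Prop :=
  [/\ size s = k, {subset s <= H} & \sum_(h <- s) h = g].

Definition is_gcd_of (S : nat -> Prop) (g : nat) : Prop :=
  (forall l, S l -> (g %| l)%N) /\
  (forall d, (forall l, S l -> (d %| l)%N) -> (d %| g)%N).

Definition aperiodic : Prop :=
  is_gcd_of (fun l => (1 <= l)%N /\ exists s, is_representation l 0 s) 1.

Definition cayley_le (u v : G * int) : Prop :=
  u.2 <= v.2 /\ exists s, is_representation `|v.2 - u.2|%N (v.1 - u.1) s.

Definition strong_chain (u v w : G * int) : Prop :=
  [/\ uniq [:: u; v; w],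
      cayley_le u v,
      cayley_le v w
    & exists2 h : G, h \in H &
        (exists2 s, is_representation `|v.2 - u.2|%N (v.1 - u.1) s & h \in s) /\
        (exists2 s, is_representation `|w.2 - v.2|%N (w.1 - v.1) s & h \in s)].

Definition strongly_diamond_free (Pi : {fset G * int}) : Prop :=
  diamond_free cayley_le (mem Pi) /\
  ~ exists u v w : G * int,
      [/\ u \in Pi, v \in Pi, w \in Pi & strong_chain u v w].

End CayleyPosets.

Definition cayley_family (G : finZmodType) (n : nat) (w : 'I_n -> G)
    (Pi : {fset G * int}) : {set {set 'I_n}} :=
  (\bigcup_(p <- Pi)
     [set A : {set 'I_n} |
       ((#|A|%:Z == (n./2)%:Z + p.2) && (\sum_(x in A) w x == p.1))%R])%SET.

Section IID.
Local Open Scope classical_set_scope.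
Local Open Scope ereal_scope.
Context {R : realType} {d : measure_display} {T : measurableType d}.
Variables (P : probability T R) (G : finType).

(* Only singletons of [G] are mentioned for measurability: [G] is finite and
   carries the discrete sigma-algebra. *)
Definition discrete_random_variable (X : T -> G) : Prop :=
  forall g : G, measurable (X @^-1` [set g]).

Definition mutually_independent (I : finType) (X : I -> T -> G) : Prop :=
  forall (J : {set I}) (B : I -> set G),
    P (\bigcap_(x in [set` J]) (X x @^-1` B x)) =
    \prod_(x in J) P (X x @^-1` B x).

Definition iid_with_law (H : {set G}) (p : G -> R) (I : finType)
    (X : I -> T -> G) : Prop :=
  [/\ forall x, discrete_random_variable (X x),
      forall x t, X x t \in H,
      forall x h, h \in H -> P (X x @^-1` [set h]) = (p h)%:E
    & mutually_independent X].

End IID.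

(* Main.v *)
(* Every realisation of the random family is diamond-free: each of its sets
   has a label (weight, level) in Pi, inclusions give order relations between
   labels, and a diamond whose two middle sets share a label
   produces a strong chain. So the expected size of the family is at most
   La(n, D_2). By independence the weight of a k-set is distributed as the
   k-fold convolution power of the law on H; aperiodicity and generation make
   some power positive everywhere, hence the powers converge to the uniform law
   on G. Since the layers at bounded distance from the middle all have
   asymptotically the size of the middle one, each of the elements of Pi
   contributes 1 / #|G| to the limit. *)
Require Import Defs.
From HB Require Import structures.
From mathcomp Require Import all_boot all_order all_algebra all_fingroup.
From mathcomp Require Import finmap.
From mathcomp Require Import all_classical all_reals all_analysis.
From mathcomp Require Import cyclic measurable_realfun.
From mathcomp Require Import zify lra.

Set Implicit Arguments.
Unset Strict Implicit.
Unset Printing Implicit Defensive.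

Import Order.TTheory GRing.Theory Num.Theory.
Import numFieldNormedType.Exports.

Local Open Scope classical_set_scope.
Local Open Scope ring_scope.

Lemma card_finZmod_gt0 (G : finZmodType) : (0 < #|G|)%N.
Proof. by apply/card_gt0P; exists 0. Qed.

(* The least positive residue of [S] modulo [m] divides every element of [S]. *)
Lemma add_closed_gcd_modn (S : nat -> Prop) (m g : nat) : (0 < m)%N ->
  S 0%N -> S m -> (forall k l, S k -> S l -> S (k + l)%N) -> is_gcd_of S g ->
  exists2 l, S l & l = g %[mod m].
Proof.
move=> m_gt0 S0 Sm SD [g_dvd dvd_g].
have SM k n : S k -> S (k * n)%N.
  by move=> Sk; elim: n => [|n IHn]; rewrite ?muln0// mulnS; exact: SD.
pose residue d := (0 < d)%N && `[< exists2 l, S l & l = d %[mod m] >].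
have exists_residue : exists d, residue d.
  by exists m; rewrite /residue m_gt0; apply/asboolP; exists m.
case: (ex_minnP exists_residue) => d /andP[d_gt0 /asboolP[l Sl l_mod]] d_min.
suff <- : d = g by exists l.
apply/eqP; rewrite eqn_dvd; apply/andP; split; last first.
  have g_dvd_m := g_dvd m Sm.
  by rewrite /dvdn -(modn_dvdm d g_dvd_m) -l_mod modn_dvdm// -/(dvdn _ _) g_dvd.
apply: dvd_g => k Sk; rewrite /dvdn; apply: contraT; rewrite -lt0n => r_gt0.
suff /d_min : residue (k %% d)%N by rewrite leqNgt ltn_mod d_gt0.
rewrite /residue r_gt0; apply/asboolP; exists (k + l * (k %/ d * m.-1))%N.
  by apply: SD => //; exact: SM.
rewrite -modnDmr -modnMml l_mod modnMml modnDmr {1}(divn_eq k d).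
have -> : (k %/ d * d + k %% d + d * (k %/ d * m.-1) =
    k %/ d * d * m + k %% d)%N by rewrite -{2}(prednK m_gt0); lia.
by rewrite modnMDl.
Qed.

Section SumsOfGenerators.
Variables (G : finZmodType) (H : {set G}).

Definition is_sum_of (k : nat) (g : G) : Prop :=
  exists s, is_representation H k g s.

Lemma is_sum_of0 : is_sum_of 0 0.
Proof. by exists [::]; split=> //; rewrite big_nil. Qed.

Lemma is_sum_of1 h : h \in H -> is_sum_of 1 h.
Proof.
move=> hH; exists [:: h]; split; rewrite ?big_seq1//.
by move=> x; rewrite inE => /eqP->.
Qed.

Lemma is_sum_ofD k l g h :
  is_sum_of k g -> is_sum_of l h -> is_sum_of (k + l) (g + h).
Proof.
move=> [s [ss sH sg]] [t [st tH th]]; exists (s ++ t); split.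
- by rewrite size_cat ss st.
- by move=> x; rewrite mem_cat => /orP[/sH|/tH].
- by rewrite big_cat /= sg th.
Qed.

Lemma is_sum_ofMn k g n : is_sum_of k g -> is_sum_of (k * n) (g *+ n).
Proof.
move=> kg; elim: n => [|n IHn].
  by rewrite muln0 mulr0n; exact: is_sum_of0.
by rewrite mulnS mulrS; exact: is_sum_ofD.
Qed.

Lemma is_sum_of_pad k l n g :
  is_sum_of k g -> is_sum_of l 0 -> is_sum_of (k + l * n) g.
Proof.
move=> kg l0; rewrite -[g]addr0 -[X in _ + X](mul0rn _ n).
by apply: is_sum_ofD => //; exact: is_sum_ofMn.
Qed.

Lemma generated_is_sum_of : <<H>>%g = [set: G]%SET ->
  forall g, exists k, is_sum_of k g.
Proof.
move=> HG g; have : g \in <<H>>%g by rewrite HG inE.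
case/gen_prodgP => n [c cH ->]; exists n, [seq c i | i <- enum 'I_n]; split.
- by rewrite size_map size_enum_ord.
- by move=> x /mapP[i _ ->].
- by rewrite big_map big_enum.
Qed.

Lemma aperiodic_neq0 : aperiodic H -> H != finset.set0.
Proof.
move=> [_ gcd1]; apply/eqP => H0; suff : (2 %| 1)%N by [].
apply: gcd1 => l [l_gt0 [[|x s] [ss sH _]]]; first by move: l_gt0; rewrite -ss.
by have := sH x (mem_head _ _); rewrite H0 inE.
Qed.

Lemma is_sum_of_card0 : H != finset.set0 -> is_sum_of #|G| 0.
Proof.
case/set0Pn => h /is_sum_of1/(@is_sum_ofMn _ _ #|G|).
by rewrite mul1n -FinRing.zmodXgE -cardsT expg_cardG ?inE.
Qed.

Lemma aperiodic_is_sum_of_modn : aperiodic H ->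
  exists2 l, is_sum_of l 0 & l = 1 %[mod #|G|].
Proof.
move=> H_ap; have [_ gcd1] := H_ap.
apply: (add_closed_gcd_modn (card_finZmod_gt0 G)).
- exact: is_sum_of0.
- exact: is_sum_of_card0 (aperiodic_neq0 H_ap).
- by move=> k l k0 l0; rewrite -[0]addr0; exact: is_sum_ofD.
- by split=> [//|d d_dvd]; apply: gcd1 => l [_ l0]; exact: d_dvd.
Qed.

Lemma aperiodic_generating_is_sum_of : aperiodic H ->
  <<H>>%g = [set: G]%SET -> exists2 k, (0 < k)%N & forall g, is_sum_of k g.
Proof.
move=> H_ap HG; have [l l0 l_mod] := aperiodic_is_sum_of_modn H_ap.
have G_gt0 := card_finZmod_gt0 G.
have /choice[c c_sum] : forall g, exists c, is_sum_of (#|G| * c) g.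
  move=> g; have [k kg] := generated_is_sum_of HG g.
  have : (#|G| %| k + l * (k * #|G|.-1))%N.
    rewrite /dvdn -modnDmr -modnMml l_mod modnMml modnDmr mul1n.
    by rewrite -mulnS prednK// modnMl.
  by case/dvdnP => c ec; exists c; rewrite mulnC -ec; exact: is_sum_of_pad.
exists (#|G| * (\sum_g c g).+1)%N => [|g]; first by rewrite muln_gt0 G_gt0.
rewrite -addn1 (bigD1 g)//= -addnA mulnDr; apply: is_sum_of_pad => //.
exact: is_sum_of_card0 (aperiodic_neq0 H_ap).
Qed.

End SumsOfGenerators.

Section Convolution.
Variables (R : comPzSemiRingType) (G : finZmodType).
Implicit Types f g : G -> R.

Definition conv f g (x : G) : R := \sum_y f y * g (x - y).

Definition delta0 (x : G) : R := (x == 0)%:R.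

Definition conv_pow f (n : nat) : G -> R := iter n (conv f) delta0.

Lemma sum_subl f x : \sum_y f (x - y) = \sum_y f y.
Proof. by rewrite [RHS](reindex_inj (inv_inj (subKr x))). Qed.

Lemma sum_subr f x : \sum_y f (y - x) = \sum_y f y.
Proof. by rewrite [RHS](reindex_inj (addIr (- x))). Qed.

Lemma convC : commutative conv.
Proof.
move=> f g; apply/funext => x; rewrite /conv -(sum_subl _ x).
by apply: eq_bigr => y _; rewrite subKr mulrC.
Qed.

Lemma conv_delta0 : left_id delta0 conv.
Proof.
move=> f; apply/funext => x; rewrite /conv (bigD1 0)//= /delta0 eqxx.
by rewrite mul1r subr0 big1 ?addr0// => y /negbTE->; rewrite mul0r.
Qed.

Lemma convA : associative conv.
Proof.
move=> f g h; apply/funext => x; rewrite /conv.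
under [LHS]eq_bigr do rewrite big_distrr/=.
under [RHS]eq_bigr do rewrite big_distrl/=.
rewrite [RHS]exchange_big/=; apply: eq_bigr => y _.
rewrite [RHS](reindex_inj (addIr y))/=; apply: eq_bigr => z _.
by rewrite addrK mulrA opprD addrA addrAC.
Qed.

HB.instance Definition _ :=
  Monoid.isComLaw.Build (G -> R) delta0 conv convA convC conv_delta0.

Lemma conv_powD f m n : conv_pow f (m + n) = conv (conv_pow f m) (conv_pow f n).
Proof.
elim: m => [|m IHm]; first by rewrite conv_delta0.
by rewrite addSn /conv_pow !iterS -/(conv_pow _ _) IHm convA.
Qed.

Lemma sum_conv f g : \sum_x conv f g x = (\sum_x f x) * \sum_x g x.
Proof.
rewrite /conv exchange_big big_distrl/=; apply: eq_bigr => y _.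
by rewrite -big_distrr/= sum_subr.
Qed.

End Convolution.

Arguments conv {R G} f g x.
Arguments delta0 {R G} x.

Section ProbabilityVectors.
Variables (R : numDomainType) (G : finZmodType).
Implicit Types f g : G -> R.

Definition is_pmf f : Prop := (forall x, 0 <= f x) /\ \sum_x f x = 1.

Lemma pmf_le1 f x : is_pmf f -> f x <= 1.
Proof. by move=> [f_ge0 <-]; rewrite (bigD1 x)//= lerDl sumr_ge0. Qed.

Lemma is_pmf_delta0 : is_pmf delta0.
Proof.
split=> [x|]; first exact: ler0n.
by rewrite (bigD1 0)//= /delta0 eqxx big1 ?addr0// => x /negbTE->.
Qed.

Lemma is_pmf_conv f g : is_pmf f -> is_pmf g -> is_pmf (conv f g).
Proof.
move=> [f_ge0 f1] [g_ge0 g1]; split; last by rewrite sum_conv f1 g1 mulr1.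
by move=> x; rewrite sumr_ge0// => y _; rewrite mulr_ge0.
Qed.

Lemma is_pmf_conv_pow f n : is_pmf f -> is_pmf (conv_pow f n).
Proof.
move=> f_pmf; elim: n => [|n IHn]; first exact: is_pmf_delta0.
exact: is_pmf_conv.
Qed.

Lemma conv_pow_gt0 (H : {set G}) f n x :
  is_pmf f -> (forall h, h \in H -> 0 < f h) -> is_sum_of H n x ->
  0 < conv_pow f n x.
Proof.
move=> f_pmf f_gt0 [s [<- sH <-]]; have [f_ge0 _] := f_pmf.
elim: s sH => [|h s IHs] sH; first by rewrite big_nil /= /delta0 eqxx.
rewrite big_cons /= /conv (bigD1 h)//= addrAC subrr add0r ltr_pwDl//.
  rewrite mulr_gt0 ?f_gt0 ?sH ?mem_head// IHs// => y ys.
  by rewrite sH// inE ys orbT.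
have [pow_ge0 _] := is_pmf_conv_pow (size s) f_pmf.
by rewrite sumr_ge0// => y _; rewrite mulr_ge0.
Qed.

(* On functions of zero sum, convolution by [f] and by [f - delta] agree. *)
Lemma conv_sum0_le f u delta c x : is_pmf f -> (forall y, delta <= f y) ->
  \sum_y u y = 0 -> (forall y, `|u y| <= c) ->
  `|conv f u x| <= (1 - #|G|%:R * delta) * c.
Proof.
move=> [_ f1] delta_le u0 u_le.
have -> : conv f u x = \sum_y (f y - delta) * u (x - y).
  under [RHS]eq_bigr do rewrite mulrBl.
  by rewrite sumrB -mulr_sumr sum_subl u0 mulr0 subr0.
have -> : (1 - #|G|%:R * delta) * c = \sum_y (f y - delta) * c.
  by rewrite -mulr_suml sumrB f1 sumr_const mulr_natl.
apply: (le_trans (ler_norm_sum _ _ _)); apply: ler_sum => y _.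
by rewrite normrM ger0_norm ?subr_ge0// ler_wpM2l ?subr_ge0.
Qed.

End ProbabilityVectors.

Lemma is_pmf_restrict (R : realType) (G : finZmodType) (H : {set G})
    (f : G -> R) :
  (forall h, h \in H -> 0 <= f h) ->
  \sum_(h in H) f h = 1 -> is_pmf (f \_ [set` H]).
Proof.
move=> f_ge0 f1; split=> [x|].
  by rewrite patchE mem_setE; case: ifP => // /f_ge0.
rewrite -f1 [RHS]big_mkcond.
by apply: eq_bigr => x _; rewrite patchE mem_setE.
Qed.

Section ConvergenceToUniform.
Variables (R : realType) (G : finZmodType) (f : G -> R).
Hypothesis f_pmf : is_pmf f.

Let deviation n x := conv_pow f n x - #|G|%:R^-1.

Let cardG_gt0 : 0 < #|G|%:R :> R.
Proof. by rewrite ltr0n card_finZmod_gt0. Qed.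

Let sum_deviation n : \sum_x deviation n x = 0.
Proof.
have [_ pow1] := is_pmf_conv_pow n f_pmf.
by rewrite sumrB pow1 sumr_const -[X in _ - X]mulr_natl divff ?subrr ?gt_eqF.
Qed.

Let conv_deviation m n :
  conv (conv_pow f m) (deviation n) =1 deviation (m + n).
Proof.
have [_ pow1] := is_pmf_conv_pow m f_pmf.
move=> x; rewrite /deviation conv_powD /conv.
under eq_bigr do rewrite mulrBr.
by rewrite sumrB -mulr_suml pow1 mul1r.
Qed.

Let deviation_le1 n x : `|deviation n x| <= 1.
Proof.
have pow_pmf := is_pmf_conv_pow n f_pmf; have [pow_ge0 _] := pow_pmf.
have invG_le1 : (#|G|%:R : R)^-1 <= 1.
  by rewrite invf_le1// ler1n card_finZmod_gt0.
have invG_ge0 : 0 <= (#|G|%:R : R)^-1 by rewrite invr_ge0 ltW.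
have := pmf_le1 x pow_pmf; have := pow_ge0 x.
by rewrite ler_norml /deviation => ? ?; apply/andP; split; lra.
Qed.

Lemma conv_pow_uniform_geometric k delta n x :
  (forall y, delta <= conv_pow f k y) ->
  `|conv_pow f n x - #|G|%:R^-1| <= (1 - #|G|%:R * delta) ^+ (n %/ k).
Proof.
move=> delta_le; rewrite -/(deviation n x) {1}(divn_eq n k).
elim: (n %/ k)%N x => [|q IHq] x; first exact: deviation_le1.
rewrite mulSn -addnA -conv_deviation exprS.
exact: conv_sum0_le (is_pmf_conv_pow k f_pmf) _ (sum_deviation _) _.
Qed.

Lemma conv_pow_cvg_uniform k x : (0 < k)%N -> (forall y, 0 < conv_pow f k y) ->
  conv_pow f n x @[n --> \oo] --> (#|G|%:R : R)^-1.
Proof.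
move=> k_gt0 pow_gt0; pose delta := \big[Num.min/1]_y conv_pow f k y.
have delta_le y : delta <= conv_pow f k y by exact: bigmin_le.
have delta_gt0 : 0 < delta by exact: lt_bigmin.
have rate_ge0 : 0 <= 1 - #|G|%:R * delta.
  have [_ pow1] := is_pmf_conv_pow k f_pmf.
  by rewrite subr_ge0 -[leRHS]pow1 mulr_natl -sumr_const; exact: ler_sum.
have rate_lt1 : `|1 - #|G|%:R * delta| < 1.
  by rewrite ger0_norm// gtrBl mulr_gt0.
have divn_cvg : (n %/ k)%N @[n --> \oo] --> \oo.
  by apply/cvgnyPge => A; exists (A * k)%N => // n /=; rewrite leq_divRL.
apply/subr_cvg0/norm_cvg0P.
apply: (@squeeze_cvgr _ _ _ _ (cst 0)
  (fun n => (1 - #|G|%:R * delta) ^+ (n %/ k))).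
- by apply: nearW => n; rewrite normr_ge0 conv_pow_uniform_geometric.
- exact: cvg_cst.
- exact: cvg_comp divn_cvg (cvg_expr rate_lt1).
Qed.

End ConvergenceToUniform.

Lemma aperiodic_conv_pow_cvg (R : realType) (G : finZmodType) (H : {set G})
    (f : G -> R) x :
  aperiodic H -> <<H>>%g = [set: G]%SET ->
  is_pmf f -> (forall h, h \in H -> 0 < f h) ->
  conv_pow f n x @[n --> \oo] --> (#|G|%:R : R)^-1.
Proof.
move=> H_ap HG f_pmf f_gt0.
have [k k_gt0 k_sum] := aperiodic_generating_is_sum_of H_ap HG.
apply: (conv_pow_cvg_uniform f_pmf x k_gt0) => y.
exact: conv_pow_gt0 f_pmf f_gt0 (k_sum y).
Qed.

Lemma le_limn_einf (R : realType) (u v : nat -> \bar R) :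
  (forall n, (u n <= v n)%E) -> (limn_einf u <= limn_einf v)%E.
Proof.
move=> uv; rewrite !limn_einf_lim; apply: lee_lim; try exact: is_cvg_einfs.
apply: nearW => n; apply: le_ereal_inf_tmp => _ /= [k nk <-].
by apply: le_trans (uv k); apply: ereal_inf_lbound; exists k.
Qed.

(* The middle is [n./2]; the absolute value is only meaningful once
   [n./2 + j >= 0], [mid_layer n j] being empty otherwise. *)
Definition mid_level (n : nat) (j : int) : nat := `|(n./2%:Z + j)%R|%N.

Definition mid_layer (n : nat) (j : int) : {set {set 'I_n}} :=
  [set A : {set 'I_n} | #|A|%:Z == n./2%:Z + j]%SET.

Lemma card_mem_mid_layer (n : nat) (j : int) (A : {set 'I_n}) :
  A \in mid_layer n j -> #|A| = mid_level n j.
Proof. by rewrite inE /mid_level => /eqP<-. Qed.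

Lemma card_mid_layer (n : nat) (j : int) : 0 <= n./2%:Z + j ->
  #|mid_layer n j| = 'C(n, mid_level n j).
Proof.
move=> level_ge0; rewrite -[X in 'C(X, _)]card_ord -card_draws.
by apply: eq_card => A; rewrite !inE -eqz_nat gez0_abs.
Qed.

Section MiddleLevels.
Variable R : realType.

Lemma natr_ratio_cvg1 (c : nat) (a b : nat -> nat) : b @ \oo --> \oo ->
  (\forall n \near \oo, (a n <= b n + c)%N && (b n <= a n + c)%N) ->
  (a n)%:R / (b n)%:R @[n --> \oo] --> (1 : R).
Proof.
move=> b_cvg ab; apply/subr_cvg0/norm_cvg0P.
apply: (@squeeze_cvgr _ _ _ _ (cst 0) (fun n => c%:R * (b n)%:R^-1 : R)).
- near=> n; rewrite normr_ge0/=.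
  have b_gt0 : 0 < (b n)%:R :> R.
    by rewrite ltr0n; near: n; move/cvgnyPge : b_cvg; exact.
  rewrite -[X in _ - X](@divff _ (b n)%:R) ?gt_eqF// -mulrBl.
  rewrite normrM normfV (gtr0_norm b_gt0) ler_pM2r ?invr_gt0// ler_norml.
  have /andP[] : (a n <= b n + c)%N && (b n <= a n + c)%N by near: n.
  by rewrite -!(ler_nat R) !natrD => ? ?; apply/andP; split; lra.
- exact: cvg_cst.
- rewrite -(mulr0 (c%:R : R)); apply: cvgMr.
  apply/gtr0_cvgV0; last exact/cvgrnyP.
  by move/cvgnyPge : b_cvg => /(_ 1%N); apply: filterS => n; rewrite ltr0n.
Unshelve. all: by end_near. Qed.

Lemma near_half_ge (j : int) : \forall n \near \oo, j <= n./2%:Z.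
Proof. by exists `|j|%N.*2 => // n /=; rewrite -geq_half_double; lia. Qed.

Lemma mid_level_cvgny (j : int) : mid_level n j @[n --> \oo] --> \oo.
Proof.
apply/cvgnyPge => A; have := near_half_ge (`|j| + A%:Z).
by apply: filterS => n; rewrite /mid_level; lia.
Qed.

Lemma bin_mid_level_gt0 (j : int) :
  \forall n \near \oo, 0 < 'C(n, mid_level n j)%:R :> R.
Proof.
have := near_half_ge `|j|; apply: filterS => n.
by rewrite ltr0n bin_gt0 /mid_level; lia.
Qed.

Lemma bin_mid_level_succ_ratio_cvg1 (j : int) :
  'C(n, mid_level n (j + 1))%:R / 'C(n, mid_level n j)%:R @[n --> \oo] -->
  (1 : R).
Proof.
have ratio_cvg : (n - mid_level n j)%:R / (mid_level n (j + 1))%:R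
    @[n --> \oo] --> (1 : R).
  apply: (@natr_ratio_cvg1 (2 * `|j| + 1)%N); first exact: mid_level_cvgny.
  have := near_half_ge (`|j| + 1); apply: filterS => n.
  by rewrite /mid_level; lia.
apply: cvg_trans ratio_cvg; apply: near_eq_cvg; near=> n.
have bin_neq0 : 'C(n, mid_level n j)%:R != 0 :> R.
  by rewrite gt_eqF//; near: n; exact: bin_mid_level_gt0.
have level_succ : mid_level n (j + 1) = (mid_level n j).+1.
  have : `|j| + 1 <= n./2%:Z by near: n; exact: near_half_ge.
  by rewrite /mid_level; lia.
rewrite /= level_succ; apply/eqP; rewrite eqr_div// ?pnatr_eq0//.
by rewrite -!natrM [in eqbRHS]mulnC mul_bin_left.
Unshelve. all: by end_near. Qed.

Lemma bin_mid_level_ratio_cvg1 (j : int) :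
  'C(n, mid_level n j)%:R / 'C(n, n./2)%:R @[n --> \oo] --> (1 : R).
Proof.
elim/int_ind: j => [|r IHr|r IHr].
- apply: cvg_near_cst; near=> n.
  rewrite /mid_level addr0 divff// pnatr_eq0 -lt0n bin_gt0; lia.
- rewrite -[X in _ --> X](mulr1 1).
  apply: cvg_trans (cvgM IHr (bin_mid_level_succ_ratio_cvg1 r)).
  apply: near_eq_cvg; near=> n; rewrite /=.
  have bin_gt0 : 0 < 'C(n, mid_level n r)%:R :> R.
    by near: n; exact: bin_mid_level_gt0.
  by rewrite mulrC mulrA divfK ?gt_eqF// intS addrC.
- have succ_ratio_cvg := bin_mid_level_succ_ratio_cvg1 (- r.+1%:Z).
  rewrite -[X in _ --> X](divr1 1).
  apply: cvg_trans (cvgM IHr (cvgV (oner_neq0 R) succ_ratio_cvg)).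
  apply: near_eq_cvg; near=> n; rewrite /=.
  have bin_gt0 : 0 < 'C(n, mid_level n (- r%:Z))%:R :> R.
    by near: n; exact: bin_mid_level_gt0.
  rewrite invf_div (_ : - r.+1%:Z + 1 = - r%:Z); last lia.
  by rewrite mulrC mulrA divfK ?gt_eqF.
Unshelve. all: by end_near. Qed.

Lemma card_mid_layer_ratio_cvg (j : int) (f : nat -> R) (l : R) :
  f @ \oo --> l ->
  #|mid_layer n j|%:R * f (mid_level n j) / 'C(n, n./2)%:R @[n --> \oo] --> l.
Proof.
move=> f_cvg; rewrite -[X in _ --> X]mul1r.
have f_level_cvg : f (mid_level n j) @[n --> \oo] --> l.
  exact: cvg_comp (mid_level_cvgny j) f_cvg.
apply: cvg_trans (cvgM (bin_mid_level_ratio_cvg1 j) f_level_cvg).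
apply: near_eq_cvg; near=> n; rewrite /=.
rewrite mulrAC card_mid_layer//.
have : `|j| <= n./2%:Z by near: n; exact: near_half_ge.
lia.
Unshelve. all: by end_near. Qed.

End MiddleLevels.

Section FinitePreimages.
Context {d : measure_display} {T : measurableType d}.
Variables (U : choiceType) (Y : T -> U).
Hypothesis mY : forall u, measurable (Y @^-1` [set u]).

Lemma measurable_finite_preimage (D : set U) :
  finite_set D -> measurable (Y @^-1` D).
Proof.
have -> : Y @^-1` D = \bigcup_(u in D) (Y @^-1` [set u]).
  by apply/seteqP; split=> [t Dt|t [u Du /= Yu]]; [exists (Y t)|rewrite /= Yu].
by move=> D_fin; exact: fin_bigcup_measurable.
Qed.

Lemma measure_finite_preimage (R : realType) (mu : {measure set T -> \bar R})
    (A : set T) (s : seq U) : measurable A -> uniq s ->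
  mu (A `&` Y @^-1` [set` s]) = (\sum_(u <- s) mu (A `&` Y @^-1` [set u]))%E.
Proof.
move=> mA s_uniq; rewrite fsbig_seq// -measure_fin_bigcup//.
- congr (mu _); apply/seteqP; split=> [t [At Yt]|t [u us [At /= Yu]]].
    by exists (Y t).
  by split=> //=; rewrite Yu.
- by move=> u v _ _ [t [[_ <-] [_ <-]]].
- by move=> u _; exact: measurableI.
Qed.

End FinitePreimages.

Section DiscreteRandomVariables.
Context {R : realType} {d : measure_display} {T : measurableType d}.
Variable P : probability T R.

Definition law (G : finType) (Y : T -> G) (g : G) : R :=
  fine (P (Y @^-1` [set g])).

Section OneVariable.
Variables (G : finType) (Y : T -> G).
Hypothesis Y_discrete : Defs.discrete_random_variable Y.

Lemma lawE g : P (Y @^-1` [set g]) = (law Y g)%:E.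
Proof. by rewrite fineK// fin_num_measure//; exact: Y_discrete. Qed.

Lemma measurable_discrete_preimage (B : set G) : measurable (Y @^-1` B).
Proof. by apply: measurable_finite_preimage => //; exact: finite_finset. Qed.

Lemma probability_discrete_partition (A : set T) : measurable A ->
  P A = (\sum_g P (A `&` Y @^-1` [set g]))%E.
Proof.
move=> mA; rewrite -measure_finite_preimage ?index_enum_uniq//.
congr (P _); apply/seteqP; split=> t /= => [At|[]//].
by split=> //=; exact: mem_index_enum.
Qed.

End OneVariable.

Section Sums.
Variable G : finZmodType.

Lemma discrete_random_variableD (Y Z : T -> G) :
  Defs.discrete_random_variable Y -> Defs.discrete_random_variable Z ->
  Defs.discrete_random_variable (fun t => Y t + Z t).
Proof.
move=> Y_discrete Z_discrete g.
have -> : (fun t => Y t + Z t) @^-1` [set g] =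
    \bigcup_h (Y @^-1` [set h] `&` Z @^-1` [set g - h]).
  apply/seteqP; split=> [t /= <-|t [h _ [/= -> ->]]].
    by exists (Y t) => //; split=> //=; rewrite addrAC subrr add0r.
  by rewrite addrC subrK.
apply: fin_bigcup_measurable => [|h _]; first exact: finite_finset.
exact: measurableI.
Qed.

Lemma discrete_random_variable_sum (I : Type) (s : seq I) (Q : pred I)
    (X : I -> T -> G) :
  (forall x, Defs.discrete_random_variable (X x)) ->
  Defs.discrete_random_variable (fun t => \sum_(x <- s | Q x) X x t).
Proof.
move=> X_discrete; under eq_fun do rewrite -big_filter.
elim: (seq.filter Q s) => [|x r IHr].
  by under eq_fun do rewrite big_nil; move=> g; rewrite preimage_cst; case: ifP.
by under eq_fun do rewrite big_cons; exact: discrete_random_variableD.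
Qed.

End Sums.

End DiscreteRandomVariables.

Section SumsOfIndependentVariables.
Context {R : realType} {d : measure_display} {T : measurableType d}.
Variables (P : probability T R) (G : finZmodType) (I : finType).
Variable X : I -> T -> G.
Hypothesis X_discrete : forall x, Defs.discrete_random_variable (X x).
Hypothesis X_independent : mutually_independent P X.

Definition cylinder (J : {set I}) (B : I -> set G) : set T :=
  \bigcap_(x in [set` J]) (X x @^-1` B x).

Lemma measurable_cylinder (J : {set I}) (B : I -> set G) :
  measurable (cylinder J B).
Proof.
apply: fin_bigcap_measurable => [|x _]; first exact: finite_finset.
exact: measurable_discrete_preimage.
Qed.

Lemma cylinderU1 (x : I) (J : {set I}) (B : I -> set G) (C : set G) :
  x \notin J ->
  cylinder (x |: J) (dfwith B x C) = cylinder J B `&` X x @^-1` C.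
Proof.
move=> xJ; apply/seteqP; split=> [t t_xJ|t [t_J t_x] y /=].
  split=> [y /= yJ|].
    have := t_xJ y; rewrite /= dfwithout ?inE ?yJ ?orbT; first exact.
    by apply: contraNneq xJ => ->.
  by have := t_xJ x; rewrite /= dfwithin !inE eqxx; exact.
rewrite !inE; case: dfwithP => [//|z x_z]; rewrite eq_sym (negbTE x_z).
exact: t_J.
Qed.

Lemma probability_cylinderU1 (x : I) (J : {set I}) (B : I -> set G)
    (C : set G) : x \notin J ->
  P (cylinder J B `&` X x @^-1` C) = (P (cylinder J B) * P (X x @^-1` C))%E.
Proof.
move=> xJ; rewrite -cylinderU1// !X_independent big_setU1//= dfwithin muleC.
congr (_ * _)%E; apply: eq_bigr => y yJ; rewrite dfwithout//.
by apply: contraNneq xJ => ->.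
Qed.

Lemma cylinder_sum_cons (x : I) (s : seq I) (J : {set I}) (B : I -> set G)
    (g h : G) : x \notin J ->
  cylinder J B `&` [set t | \sum_(y <- x :: s) X y t = g] `&`
    X x @^-1` [set h] =
  cylinder (x |: J) (dfwith B x [set h]) `&`
    [set t | \sum_(y <- s) X y t = g - h].
Proof.
move=> xJ; rewrite cylinderU1// -!setIA; congr (_ `&` _).
apply/seteqP; split=> t /=; rewrite big_cons => -[].
  by move=> <- ->; rewrite addrAC subrr add0r.
by move=> -> ->; rewrite addrC subrK.
Qed.

(* The cylinder makes the induction on [s] go through: conditioning on the value
   of the head of [s] moves that index into [J]. *)
Lemma probability_cylinder_sum (s : seq I) (J : {set I}) (B : I -> set G) g :
  uniq s -> {in s, forall x, x \notin J} ->
  P (cylinder J B `&` [set t | \sum_(x <- s) X x t = g]) =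
  (P (cylinder J B) *
   ((\big[conv/delta0]_(x <- s) law P (X x)) g)%:E)%E.
Proof.
elim: s J B g => [|x s IHs] J B g.
  move=> _ _; rewrite big_nil /delta0; under eq_set do rewrite big_nil.
  have [->|g_neq0] := eqVneq g 0.
    by rewrite (_ : [set _ | _] = setT) ?setIT ?mule1//; apply/seteqP.
  rewrite (_ : [set _ | _] = set0) ?setI0 ?measure0 ?mule0//.
  by apply/seteqP; split=> // t /= g0; rewrite -g0 eqxx in g_neq0.
move=> /= /andP[xs s_uniq] sJ.
have xJ : x \notin J by apply: sJ; exact: mem_head.
have s_xJ : {in s, forall y, y \notin x |: J}%SET.
  move=> y ys; rewrite !inE negb_or sJ ?inE ?ys ?orbT// andbT.
  by apply: contraNneq xs => <-.
rewrite (probability_discrete_partition P (X_discrete x)); last first.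
  apply: measurableI; first exact: measurable_cylinder.
  exact: (discrete_random_variable_sum (x :: s) xpredT X_discrete).
have [c Pc] : exists c, P (cylinder J B) = c%:E.
  by exists (fine (P (cylinder J B))); rewrite fineK// fin_num_measure//;
    exact: measurable_cylinder.
rewrite big_cons Pc -EFinM /conv mulr_sumr -sumEFin; apply: eq_bigr => h _.
rewrite cylinder_sum_cons// IHs// cylinderU1// probability_cylinderU1// Pc.
by rewrite (lawE P (X_discrete x)) -!EFinM mulrA.
Qed.

Lemma law_sum_independent (A : {set I}) :
  law P (fun t => \sum_(x in A) X x t) =
  \big[conv/delta0]_(x in A) law P (X x).
Proof.
apply/funext => g; apply: EFin_inj; rewrite -lawE; last first.
  exact: discrete_random_variable_sum.
have := @probability_cylinder_sum (enum A) finset.set0 (fun=> setT) g.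
have -> : cylinder finset.set0 (fun=> setT) = setT.
  by apply/seteqP; split=> // t _ x.
rewrite setTI probability_setT mul1e big_enum enum_uniq => <- //.
- by congr (P _); apply/seteqP; split=> t /=; rewrite big_enum.
- by move=> x _; rewrite inE.
Qed.

End SumsOfIndependentVariables.

Lemma iid_law (R : realType) (d : measure_display) (T : measurableType d)
    (P : probability T R) (G : finZmodType) (H : {set G}) (p : G -> R)
    (I : finType) (X : I -> T -> G) x :
  iid_with_law P H p X -> law P (X x) = p \_ [set` H].
Proof.
move=> [X_discrete XH Xp _]; apply/funext => g; rewrite /law patchE mem_setE.
case: ifPn => [gH|gH]; first by rewrite Xp.
rewrite (_ : X x @^-1` [set g] = set0) ?measure0//.
apply/seteqP; split=> // t /= Xg.
by rewrite -Xg XH in gH.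
Qed.

Section RandomFiniteSets.
Context {R : realType} {d : measure_display} {T : measurableType d}.
Variable P : probability T R.
Variables (J : finType) (F : T -> {set J}).
Hypothesis mF : forall j, measurable [set t | j \in F t].

Let card_indic t : #|F t|%:R = \sum_j \1_[set t | j \in F t] t :> R.
Proof.
rewrite -sum1_card natr_sum big_mkcond; apply: eq_bigr => j _.
rewrite indicE; case: ifPn => jF; first by rewrite mem_set.
by rewrite memNset//; exact/negP.
Qed.

Lemma measurable_card : measurable_fun setT (fun t => #|F t|%:R : R).
Proof.
under eq_fun do rewrite card_indic.
by apply: measurable_sum => j; exact: measurable_indic.
Qed.

Lemma expectation_card :
  ('E_P[fun t => #|F t|%:R] = \sum_j P [set t | j \in F t])%E.
Proof.
rewrite unlock; under eq_integral do rewrite card_indic -sumEFin.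
rewrite ge0_integral_sum//= => [|j]; last first.
  by apply/measurable_EFinP; exact: measurable_indic.
by apply: eq_bigr => j _; rewrite integral_indic// setIT.
Qed.

End RandomFiniteSets.

Section CayleyLabels.
Variables (G : finZmodType) (H : {set G}) (n : nat) (w : 'I_n -> G).

(* The only element of the infinite Cayley poset whose layer of the family
   can contain [A]. *)
Definition cayley_label (A : {set 'I_n}) : G * int :=
  (\sum_(x in A) w x, #|A|%:Z - n./2%:Z).

Lemma cayley_label_eq A u :
  (cayley_label A == u) = (A \in mid_layer n u.2) && (\sum_(x in A) w x == u.1).
Proof. by case: u => g j; rewrite xpair_eqE andbC subr_eq addrC inE. Qed.

Lemma in_cayley_family (Pi : {fset G * int}) A :
  (A \in cayley_family w Pi) = (cayley_label A \in Pi).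
Proof.
rewrite /cayley_family -[RHS]/(cayley_label A \in enum_fset Pi).
elim: (enum_fset Pi) => [|u s IHs]; first by rewrite big_nil inE.
by rewrite big_cons !inE IHs cayley_label_eq inE.
Qed.

Hypothesis wH : forall x, w x \in H.

Lemma cayley_label_representation (A B : {set 'I_n}) : A \subset B ->
  is_representation H `|(cayley_label B).2 - (cayley_label A).2|%N
    ((cayley_label B).1 - (cayley_label A).1) [seq w x | x <- enum (B :\: A)].
Proof.
move=> AB; have card_AB := subset_leq_card AB; split.
- by rewrite size_map -cardE cardsD (finset.setIidPr AB) /=
    opprB addrA subrK subzn.
- by move=> _ /mapP[x _ ->].
- rewrite big_map big_enum/= [in RHS](big_setID A)/= (finset.setIidPr AB).
  by rewrite addrAC subrr add0r.
Qed.

Lemma cayley_label_le (A B : {set 'I_n}) : A \subset B ->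
  cayley_le H (cayley_label A) (cayley_label B).
Proof.
move=> AB; split; last by eexists; exact: cayley_label_representation.
by rewrite lerD2r lez_nat subset_leq_card.
Qed.

Lemma cayley_label_neq (A B : {set 'I_n}) : A \proper B ->
  cayley_label A != cayley_label B.
Proof.
move=> /proper_card; apply: contraTneq => -[_ /(addIr _)[->]].
by rewrite ltnn.
Qed.

(* An element of [B] outside [C] contributes its weight to both gaps. *)
Lemma cayley_label_strong_chain (A B C D : {set 'I_n}) :
  A \proper B -> B \proper D -> A \subset C -> C \subset D ->
  ~~ (B \subset C) -> cayley_label B = cayley_label C ->
  strong_chain H (cayley_label A) (cayley_label B) (cayley_label D).
Proof.
move=> AB BD AC CD /fintype.subsetPn[x xB xC] label_BC; split.
- have AD := proper_trans AB BD.
  by rewrite /= !inE negb_or !cayley_label_neq.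
- exact: cayley_label_le (proper_sub AB).
- exact: cayley_label_le (proper_sub BD).
exists (w x); first exact: wH; split.
- eexists; first exact: cayley_label_representation (proper_sub AB).
  rewrite map_f// mem_enum !inE xB andbT.
  by apply: contraNN xC; exact: fintype.subsetP AC x.
- rewrite label_BC; eexists; first exact: cayley_label_representation CD.
  by rewrite map_f// mem_enum !inE xC (fintype.subsetP (proper_sub BD)).
Qed.

Lemma cayley_family_diamond_free (Pi : {fset G * int}) :
  strongly_diamond_free H Pi ->
  diamond_free (fun A B : {set 'I_n} => A \subset B) (mem (cayley_family w Pi)).
Proof.
move=> [Pi_diamond_free Pi_no_strong_chain] [A [B [C [D []]]]] [].
rewrite -![_ \in mem _]/(_ \in cayley_family w Pi) !in_cayley_family.
move=> APi BPi CPi DPi; rewrite /= !inE !negb_or !andbT.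
move=> /and3P[/and3P[AnB AnC AnD] /andP[BnC BnD] CnD] [sAB sBD] [sAC sCD].
have AB : A \proper B by rewrite finset.properEneq AnB.
have AC : A \proper C by rewrite finset.properEneq AnC.
have BD : B \proper D by rewrite finset.properEneq BnD.
have CD : C \proper D by rewrite finset.properEneq CnD.
have [label_BC|label_BnC] := eqVneq (cayley_label B) (cayley_label C).
  have BnsC : ~~ (B \subset C).
    apply: contra_eqN label_BC => sBC; apply: cayley_label_neq.
    by rewrite finset.properEneq BnC.
  apply: Pi_no_strong_chain.
  exists (cayley_label A), (cayley_label B), (cayley_label D); split=> //.
  exact: cayley_label_strong_chain AB BD sAC sCD BnsC label_BC.
apply: Pi_diamond_free; exists (cayley_label A), (cayley_label B),
  (cayley_label C), (cayley_label D); split=> //.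
- have AD := proper_trans AB BD.
  by rewrite /= !inE !negb_or label_BnC !cayley_label_neq.
- by split; exact: cayley_label_le.
- by split; exact: cayley_label_le.
Qed.

Lemma card_cayley_family_le (Pi : {fset G * int}) :
  strongly_diamond_free H Pi -> (#|cayley_family w Pi| <= La_diamond n)%N.
Proof.
move=> /cayley_family_diamond_free family_diamond_free.
rewrite /La_diamond (bigD1 (cayley_family w Pi))/= ?leq_maxl//.
exact/asboolP.
Qed.

End CayleyLabels.

Section RandomCayleyFamily.
Context {R : realType} {d : measure_display} {T : measurableType d}.
Variables (P : probability T R) (G : finZmodType) (n : nat).
Variables (X : 'I_n -> T -> G) (Pi : {fset G * int}).
Hypothesis X_discrete : forall x, Defs.discrete_random_variable (X x).

Let label_eventE A u : (fun t => cayley_label (X^~ t) A) @^-1` [set u] =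
  if A \in mid_layer n u.2 then (fun t => \sum_(x in A) X x t) @^-1` [set u.1]
  else set0.
Proof.
have label_eqP t : reflect (cayley_label (X^~ t) A = u)
    ((A \in mid_layer n u.2) && (\sum_(x in A) X x t == u.1)).
  by rewrite -cayley_label_eq; exact: eqP.
case: ifPn => A_layer; apply/seteqP; split=> // t /=.
- by move/label_eqP/andP => [_ /eqP].
- by move=> sumE; apply/label_eqP; rewrite A_layer sumE eqxx.
- by move/label_eqP; rewrite (negbTE A_layer).
Qed.

Let measurable_label_event A u :
  measurable ((fun t => cayley_label (X^~ t) A) @^-1` [set u]).
Proof.
by rewrite label_eventE; case: ifP => // _; exact: discrete_random_variable_sum.
Qed.

Lemma measurable_mem_cayley_family A :
  measurable [set t | A \in cayley_family (X^~ t) Pi].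
Proof.
under eq_set do rewrite in_cayley_family.
exact: (measurable_finite_preimage (measurable_label_event A) (finite_fset Pi)).
Qed.

Lemma expectation_card_cayley_family_le (H : {set G}) :
  (forall x t, X x t \in H) -> strongly_diamond_free H Pi ->
  ('E_P[fun t => #|cayley_family (X^~ t) Pi|%:R] <= (La_diamond n)%:R%:E)%E.
Proof.
move=> XH Pi_sdf; rewrite -(expectation_cst P); apply: expectation_le => //.
- exact: measurable_card measurable_mem_cayley_family.
- apply: aeW => t; rewrite ler_nat.
  exact: card_cayley_family_le (XH^~ t) _ Pi_sdf.
Qed.

Hypothesis X_independent : mutually_independent P X.
Variable mu : G -> R.
Hypothesis X_law : forall x, law P (X x) = mu.

Lemma probability_cayley_label A u :
  P ((fun t => cayley_label (X^~ t) A) @^-1` [set u]) =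
  (if A \in mid_layer n u.2 then conv_pow mu (mid_level n u.2) u.1 else 0)%:E.
Proof.
rewrite label_eventE; case: ifP => [A_layer|_]; last exact: measure0.
rewrite lawE; last exact: discrete_random_variable_sum.
rewrite (law_sum_independent X_discrete X_independent).
under eq_bigr do rewrite X_law.
by rewrite big_const (card_mem_mid_layer A_layer).
Qed.

Lemma expectation_card_cayley_family :
  ('E_P[fun t => #|cayley_family (X^~ t) Pi|%:R])%E =
  (\sum_(u <- Pi) #|mid_layer n u.2|%:R *
     conv_pow mu (mid_level n u.2) u.1)%:E.
Proof.
rewrite (expectation_card _ measurable_mem_cayley_family).
under eq_bigr do under eq_set do rewrite in_cayley_family.
under eq_bigr => A _.
  rewrite -[X in P X]setTI.
  rewrite (measure_finite_preimage (measurable_label_event A) P measurableT)//.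
  under eq_bigr do rewrite setTI; over.
rewrite exchange_big -sumEFin; apply: eq_bigr => u _ /=.
under eq_bigr do rewrite probability_cayley_label.
by rewrite sumEFin -big_mkcond sumr_const mulr_natl.
Qed.

End RandomCayleyFamily.

Theorem theorem2 (R : realType) (G : finZmodType) (H : {set G})
    (H_aperiodic : aperiodic H)
    (H_generates : <<H>>%g = [set: G]%SET)
    (p : G -> R)
    (p_gt0 : forall h, h \in H -> 0 < p h)
    (p_sum1 : \sum_(h in H) p h = 1)
    (d : nat -> measure_display)
    (T : forall n : nat, measurableType (d n))
    (P : forall n : nat, probability (T n) R)
    (w : forall n : nat, 'I_n -> T n -> G)
    (w_iid : forall n : nat, iid_with_law (P n) H p (w n))
    (Pi : {fset G * int})
    (Pi_sdf : strongly_diamond_free H Pi) :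
  ((fun n : nat =>
      'E_(P n)[fun t => (#|cayley_family (fun x => w n x t) Pi|)%:R]
        * (('C(n, n./2)%:R)^-1)%:E)%E @ \oo
     --> ((#|` Pi|%:R / #|G|%:R : R)%:E))
  /\ (((#|` Pi|%:R / #|G|%:R : R)%:E
      <= limn_einf (fun n : nat =>
           ((La_diamond n)%:R / 'C(n, n./2)%:R : R)%:E))%E).
Proof.
pose mu := p \_ [set` H]; have mu_pmf : is_pmf mu.
  by apply: is_pmf_restrict => // h /p_gt0/ltW.
have mu_gt0 h : h \in H -> 0 < mu h.
  by move=> hH; rewrite /mu patchE mem_setE hH p_gt0.
have layer_cvg u := card_mid_layer_ratio_cvg u.2
  (aperiodic_conv_pow_cvg u.1 H_aperiodic H_generates mu_pmf mu_gt0).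
set mean := (X in X @ \oo --> _ /\ _).
have mean_cvg : mean @ \oo --> (#|` Pi|%:R / #|G|%:R : R)%:E.
  have -> : #|` Pi|%:R / #|G|%:R = \sum_(u <- Pi) (#|G|%:R : R)^-1.
    by rewrite big_const_seq count_predT iter_addr_0 mulr_natl.
  rewrite /mean; under eq_fun => n.
    have [w_discrete _ _ w_indep] := w_iid n.
    rewrite (expectation_card_cayley_family Pi w_discrete w_indep
      (fun x => iid_law x (w_iid n))).
    rewrite -EFinM mulr_suml; over.
  apply: cvg_EFin; first exact: nearW.
  by apply: cvg_big => [|u _]; [exact: add_continuous|exact: layer_cvg].
split=> //; have [<- _] := cvg_limn_einf_sup mean_cvg.
apply: le_limn_einf => n; rewrite EFinM lee_wpmul2r ?lee_fin//.
have [w_discrete wH _ _] := w_iid n.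
exact: expectation_card_cayley_family_le w_discrete _ wH Pi_sdf.
Qed.
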